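(* Let $q$ be a prime power, let $\alpha_1,\dots,\alpha_n\in\mathbb{F}_q$ be distinct, and let $k,r$ be integers with $1\le r\le k-1$ and $k<n$. Let $H_1$ be the $(n-k+1)\times(n+1)$ matrix whose rows are, in order, $$(u_1\alpha_1^{e},u_2\alpha_2^{e},\dots,u_n\alpha_n^{e},0),\qquad e=0,1,\dots,n-k-2,$$ $$(u_1\Lambda_{r,1},u_2\Lambda_{r,2},\dots,u_n\Lambda_{r,n},0),$$ $$(u_1\alpha_1^{n-k-1},u_2\alpha_2^{n-k-1},\dots,u_n\alpha_n^{n-k-1},-1).$$ Then $H_1$ is a parity check matrix for the code $C_1$ generated by $G_1$.
   Context: For distinct $\alpha_1,\dots,\alpha_n\in\mathbb{F}_q$ and $1\le r\le k-1$, $G_{r,k}$ is the $k\times n$ matrix whose rows are $(\alpha_1^e,\alpha_2^e,\dots,\alpha_n^e)$ for $e=0,1,\dots,k-r-1,k-r+1,\dots,k$ in this order (all exponents from $0$ to $k$ except $k-r$; convention $0^0=1$). $G_1$ is the $k\times(n+1)$ matrix obtained by appending to $G_{r,k}$ the column $(0,0,\dots,0,1)^T$, and $C_1$ is the linear code over $\mathbb{F}_q$ generated by $G_1$. Notation: $u_i=\prod_{1\le j\le n,\ j\ne i}(\alpha_i-\alpha_j)^{-1}$ for $1\le i\le n$; $\sigma_t=\sum_{1\le j_1<\dots<j_t\le n}\alpha_{j_1}\cdots\alpha_{j_t}$ is the $t$-th elementary symmetric function of $\alpha_1,\dots,\alpha_n$, with $\sigma_0=1$; and $$\Lambda_{r,i}=\sum_{j=0}^r(-1)^j\sigma_j\,\alpha_i^{(n-k)+(r-1)-j}.$$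 A parity check matrix of an $[N,k]$ code $C$ is an $(N-k)\times N$ matrix with linearly independent rows whose row space is the dual code $C^\perp$ (with respect to the standard bilinear form). *)

(* Defs.v *)
From HB Require Import structures.
From mathcomp Require Import all_boot all_order all_algebra.

Set Implicit Arguments.
Unset Strict Implicit.
Unset Printing Implicit Defensive.

Import GRing.Theory.
Local Open Scope ring_scope.

Section Codes.
Variables (F : finFieldType) (N : nat).

Definition code_gen m (G : 'M[F]_(m, N)) : {vspace 'rV[F]_N} :=
  <<[seq row i G | i : 'I_m]>>%VS.

Definition dotv (x y : 'rV[F]_N) : F := \sum_(i < N) x 0 i * y 0 i.

Definition in_dual (C : {vspace 'rV[F]_N}) (v : 'rV[F]_N) : Prop :=
  forall c : 'rV[F]_N, c \in C -> dotv v c = 0.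

(* The subtraction never truncates: the dimension of C is at most N. *)
Definition is_parity_check p (C : {vspace 'rV[F]_N}) (H : 'M[F]_(p, N)) : Prop :=
  [/\ p = (N - \dim C)%N,
      free [seq row i H | i : 'I_p] &
      forall v : 'rV[F]_N, v \in code_gen H <-> in_dual C v].

End Codes.

Section Matrices.
Variables (F : finFieldType) (n k r : nat) (alpha : 'I_n -> F).

(* [bump (k - r)] enumerates the exponents 0, ..., k with k - r left out. *)
Definition Gmx : 'M[F]_(k, n) :=
  \matrix_(i < k, j < n) alpha j ^+ bump (k - r) i.

Definition G1mx : 'M[F]_(k, n + 1) :=
  row_mx Gmx (\col_(i < k) (i.+1 == k)%:R).

Definition C1 : {vspace 'rV[F]_(n + 1)} := code_gen G1mx.

Definition u (i : 'I_n) : F :=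
  \prod_(j < n | j != i) (alpha i - alpha j)^-1.

Definition sigma (t : nat) : F :=
  \sum_(A : {set 'I_n} | #|A| == t) \prod_(j in A) alpha j.

(* For k < n and 0 < r the exponent is at least n - k - 1, so that no
   subtraction truncates. *)
Definition Lambda (i : 'I_n) : F :=
  \sum_(0 <= j < r.+1)
    (-1) ^+ j * sigma j * alpha i ^+ ((n - k) + (r - 1) - j).

Definition H1mx : 'M[F]_(n - k + 1, n + 1) :=
  row_mx
    (\matrix_(i < n - k + 1, j < n)
       (u j * (if (i < n - k - 1)%N then alpha j ^+ i
               else if i == (n - k - 1)%N :> nat then Lambda j
               else alpha j ^+ (n - k - 1))))
    (\col_(i < n - k + 1) (if i == (n - k)%N :> nat then -1 else 0)).

End Matrices.

(* Main.v *)
(* The weights u_i are those of Lagrange interpolation, so the sum of the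
   u_i p(alpha_i) is the coefficient of X^(n-1) in p when deg p < n. Hence
   power sums weighted by u vanish in degree below n - 1 and equal 1 in degree
   n - 1; together with the vanishing of the nodal polynomial at the alpha_i,
   this gives H1 * G1^T = 0. Both matrices have independent rows, since a
   polynomial of degree less than n vanishing at the n points alpha_i is zero,
   and their ranks add up to n + 1. *)
Require Import Defs.
From HB Require Import structures.
From mathcomp Require Import all_boot all_order all_algebra.
From mathcomp Require Import zify.

Set Implicit Arguments.
Unset Strict Implicit.
Unset Printing Implicit Defensive.

Import GRing.Theory.
Local Open Scope ring_scope.

(** * Linear codes, their generators and duals *)

Section LinearCodes.
Variables (F : finFieldType) (N : nat).

(** Viewing the code as the image of [v |-> v *m G] turns membership into row-space membership and
    dimension into injectivity of this map. *)
Lemma code_gen_limg m (G : 'M[F]_(m, N)) :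
  code_gen G = limg (linfun (mulmxr G : 'rV_m -> 'rV_N)).
Proof.
apply/eqP; rewrite eqEsubv; apply/andP; split.
  apply/span_subvP => _ /imageP[i _ ->].
  by rewrite rowE -[delta_mx 0 i *m G](lfunE (mulmxr G)) memv_img ?memvf.
apply/subvP => _ /memv_imgP[v _ ->]; rewrite lfunE /= mulmx_sum_row.
apply: memv_suml => i _; apply/memvZ/memv_span.
by apply/imageP; exists i.
Qed.

Lemma mem_code_gen m (G : 'M[F]_(m, N)) (v : 'rV_N) :
  (v \in code_gen G) = (v <= G)%MS.
Proof.
rewrite code_gen_limg; apply/memv_imgP/submxP => [[w _ ->]|[w ->]].
  by exists w; rewrite lfunE.
by exists w; rewrite ?memvf ?lfunE.
Qed.

Lemma dim_code_gen m (G : 'M[F]_(m, N)) : row_free G -> \dim (code_gen G) = m.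
Proof.
move=> freeG; rewrite code_gen_limg limg_dim_eq; first by rewrite dimvf /dim /= mul1n.
apply/eqP; rewrite capfv; apply/lker0P => v w; rewrite !lfunE /=.
exact: row_free_inj.
Qed.

Lemma free_rows m (G : 'M[F]_(m, N)) :
  row_free G -> free [seq row i G | i : 'I_m].
Proof.
move=> /dim_code_gen dimG.
by rewrite /free size_image card_ord -[X in _ == X]dimG.
Qed.

Lemma dotv_mulmx (x y : 'rV[F]_N) : dotv x y = (x *m y^T) 0 0.
Proof. by rewrite mxE; apply: eq_bigr => i _; rewrite mxE. Qed.

Lemma in_dual_code_gen m (G : 'M[F]_(m, N)) (v : 'rV_N) :
  in_dual (code_gen G) v <-> v *m G^T = 0.
Proof.
split=> [dual_v | vG0 c].
  apply/rowP => i; rewrite [RHS]mxE.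
  have <- : dotv v (row i G) = (v *m G^T) 0 i.
    by rewrite dotv_mulmx !mxE; apply: eq_bigr => j _; rewrite !mxE.
  by apply: dual_v; rewrite mem_code_gen row_sub.
rewrite mem_code_gen => /submxP[w ->].
by rewrite dotv_mulmx trmx_mul mulmxA vG0 mul0mx mxE.
Qed.

(** The rows of [H] lie in the kernel of [G^T], which has dimension N - m = p; as [H] has rank p,
    the inclusion is an equality. *)
Lemma parity_check_of_orthogonal m p (G : 'M[F]_(m, N)) (H : 'M[F]_(p, N)) :
  row_free G -> row_free H -> H *m G^T = 0 -> (p + m)%N = N ->
  is_parity_check (code_gen G) H.
Proof.
move=> freeG freeH HG0 pm.
have subHK : (H <= kermx G^T)%MS by apply/sub_kermxP.
have eqHK : (H == kermx G^T)%MS.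
  rewrite -(geq_leqif (mxrank_leqif_eq subHK)) mxrank_ker mxrank_tr.
  by rewrite (eqP freeG) (eqP freeH) -pm addnK.
split; first by rewrite dim_code_gen // -pm addnK.
  exact: free_rows.
move=> v; rewrite mem_code_gen in_dual_code_gen (eqmxP eqHK).
by split=> [/sub_kermxP|vG0]; last exact/sub_kermxP.
Qed.

End LinearCodes.

(** * Lagrange interpolation and weighted power sums *)

Section DistinctPoints.
Variables (F : finFieldType) (n : nat) (alpha : 'I_n -> F).
Hypothesis alpha_inj : injective alpha.

Lemma poly_eq0_at_points (p : {poly F}) :
  (size p <= n)%N -> (forall i, p.[alpha i] = 0) -> p = 0.
Proof.
move=> szp p0; apply/eqP/negPn/negP => p_neq0.
suff : (n < size p)%N by rewrite ltnNge szp.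
rewrite -[n in (n < _)%N]card_ord -(size_codom alpha) max_poly_roots //.
  by apply/allP => _ /codomP[i ->]; apply/eqP/p0.
by rewrite map_inj_uniq ?enum_uniq.
Qed.

Lemma u_neq0 i : u alpha i != 0.
Proof.
apply/prodf_neq0 => j neq_ji; rewrite invr_eq0 subr_eq0.
by apply: contraNneq neq_ji => /alpha_inj ->.
Qed.

(* Both sides are the coefficient of X^(n-1) in the Lagrange interpolation
   formula for p. *)
Lemma sum_u_horner (p : {poly F}) :
  (size p <= n)%N -> \sum_i u alpha i * p.[alpha i] = p`_n.-1.
Proof.
move=> szp.
pose L i := \prod_(j < n | j != i) ('X - (alpha j)%:P).
have cardL i : #|[pred j : 'I_n | j != i]| = n.-1 by rewrite cardC1 card_ord.
have szL i : size (L i) = n.-1.+1.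
  have -> : L i = \prod_(j <- enum [pred j | j != i]) ('X - (alpha j)%:P).
    by rewrite big_enum.
  by rewrite size_prod_XsubC -cardE cardL.
have Lalpha i : (u alpha i *: L i).[alpha i] = 1.
  rewrite hornerZ horner_prod -big_split big1 //= => j neq_ji.
  rewrite hornerXsubC mulVf // subr_eq0.
  by apply: contraNneq neq_ji => /alpha_inj ->.
have Lalpha0 i l : l != i -> (u alpha i *: L i).[alpha l] = 0.
  move=> neq_li; rewrite hornerZ horner_prod (bigD1 l) //= hornerXsubC subrr.
  by rewrite mul0r mulr0.
have interp : p = \sum_i p.[alpha i] *: (u alpha i *: L i).
  apply/eqP; rewrite -subr_eq0; apply/eqP/poly_eq0_at_points => [|l].
    rewrite (leq_trans (size_polyD _ _)) // geq_max szp size_polyN.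
    apply: (leq_trans (size_sum _ _ _)); apply/bigmax_leqP => i _.
    rewrite (leq_trans (size_scale_leq _ _)) // (leq_trans (size_scale_leq _ _)) //.
    (* The index [i] forces n > 0, so that [n.-1.+1] is n. *)
    by rewrite szL; case: (n) i => [[]|].
  rewrite hornerD hornerN horner_sum (bigD1 l) //= big1 => [|i neq_il].
    by rewrite addr0 hornerZ Lalpha mulr1 subrr.
  by rewrite hornerZ Lalpha0 ?mulr0 // eq_sym.
rewrite [in RHS]interp coef_sum; apply: eq_bigr => i _.
rewrite !coefZ.
have -> : (L i)`_n.-1 = 1.
  have /monicP : L i \is monic by apply: monic_prod_XsubC.
  by rewrite /lead_coef szL.
by rewrite mulr1 mulrC.
Qed.

Lemma sum_u_exp e :
  (e < n)%N -> \sum_i u alpha i * alpha i ^+ e = (e == n.-1)%:R.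
Proof.
move=> lt_en; rewrite eq_sym -coefXn -sum_u_horner ?size_polyXn //.
by apply: eq_bigr => i _; rewrite hornerXn.
Qed.

Lemma sum_u_small_powers (a b : nat) (c : nat -> F) (f : nat -> nat) :
    (forall j, (a <= j < b)%N -> (f j < n.-1)%N) ->
  \sum_i u alpha i * \sum_(a <= j < b) c j * alpha i ^+ f j = 0.
Proof.
move=> lt_f; under eq_bigr do rewrite mulr_sumr.
rewrite exchange_big big_nat big1 //= => j /lt_f lt_fj.
under eq_bigr do rewrite mulrCA.
by rewrite -mulr_sumr sum_u_exp ?(ltn_eqF lt_fj) ?mulr0 //; lia.
Qed.

End DistinctPoints.

(** * Vieta expansion of the nodal polynomial *)

Section Nodal.
Variables (F : finFieldType) (n : nat) (alpha : 'I_n -> F).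

Lemma prod_XsubC_sigma :
  \prod_i ('X - (alpha i)%:P) =
    \sum_(0 <= j < n.+1) ((-1) ^+ j * sigma alpha j) *: 'X^(n - j).
Proof.
under eq_bigr do rewrite addrC.
rewrite bigA_distr big_mkord.
(* The set [A] collects the factors that contribute their constant term; [inord] is harmless since
   [A] has at most n elements. *)
rewrite (partition_big (fun A : {set 'I_n} => inord #|A| : 'I_n.+1) xpredT) //=.
apply: eq_bigr => j _; rewrite mulr_sumr scaler_suml.
have cardj (A : {set 'I_n}) : (inord #|A| == j) = (#|A| == j).
  by rewrite -val_eqE /= inordK // ltnS -[n in leqRHS]card_ord max_card.
apply: eq_big => [A|A]; first by rewrite cardj.
rewrite cardj => /eqP cardA; rewrite (bigID (mem A)) /=.
rewrite (eq_bigr (fun i => - (alpha i)%:P)) => [|i ->//].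
rewrite [X in _ * X](eq_bigr (fun=> 'X)) => [|i /negPf ->//].
rewrite prodrN prodr_const cardA -rmorph_prod.
have -> : #|[predC A]| = (n - j)%N.
  by rewrite -cardA -[n in (n - _)%N]card_ord -(cardC A) addKn.
by rewrite -mul_polyC polyCM rmorphXn rmorphN1.
Qed.

Lemma nodal_powers_eq0 i :
  \sum_(0 <= j < n.+1) (-1) ^+ j * sigma alpha j * alpha i ^+ (n - j) = 0.
Proof.
have := congr1 (horner^~ (alpha i)) prod_XsubC_sigma.
rewrite /= horner_prod (bigD1 i) //= hornerXsubC subrr mul0r horner_sum => sum0.
by rewrite [RHS]sum0; apply: eq_bigr => j _; rewrite hornerZ hornerXn.
Qed.

End Nodal.

(** * Orthogonality and ranks of the two matrices *)

Section ParityCheck.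
Variables (F : finFieldType) (n k r : nat) (alpha : 'I_n -> F).
Hypotheses (alpha_inj : injective alpha) (r_gt0 : (0 < r)%N).
Hypotheses (lt_rk : (r < k)%N) (lt_kn : (k < n)%N).

(* For e > k - r, Lambda times alpha^e is a truncation of alpha^(e - (k - r) - 1)
   times the nodal polynomial, which vanishes at every alpha_i; the terms cut
   off have degree less than n - 1. *)
Lemma sum_u_Lambda e : (e <= k)%N -> e != (k - r)%N ->
  \sum_i u alpha i * (Lambda k r alpha i * alpha i ^+ e) = 0.
Proof.
move=> le_ek; case: ltngtP => // [lt_e|gt_e] _.
  (* For e < k - r, all exponents are at most n - k + r - 1 + e, hence at most n - 2. *)
  transitivity (\sum_i u alpha i * \sum_(0 <= j < r.+1)
    (-1) ^+ j * sigma alpha j * alpha i ^+ ((n - k) + (r - 1) - j + e)).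
    apply: eq_bigr => i _; rewrite mulr_suml; congr (_ * _).
    by apply: eq_bigr => j _; rewrite exprD mulrA.
  apply: (sum_u_small_powers alpha_inj (fun j => (-1) ^+ j * sigma alpha j)
    (f := fun j => ((n - k) + (r - 1) - j + e)%N)) => j; lia.
transitivity (\sum_i u alpha i * \sum_(r.+1 <= j < n.+1)
  - ((-1) ^+ j * sigma alpha j) * alpha i ^+ (n - j + (e - (k - r).+1))).
  apply: eq_bigr => i _; congr (_ * _); apply/eqP.
  have := congr1 (fun x => x * alpha i ^+ (e - (k - r).+1))
    (nodal_powers_eq0 alpha i).
  rewrite /= mul0r mulr_suml (big_cat_nat (n := r.+1)) //=; last by lia.
  under [X in _ + X = _]eq_bigr do rewrite -!mulrA -exprD mulrA.
  move=> sum0; under [X in _ == X]eq_bigr do rewrite mulNr.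
  rewrite sumrN -addr_eq0; apply/eqP; rewrite -[RHS]sum0; congr (_ + _).
  rewrite mulr_suml !big_nat; apply: eq_bigr => j lt_jr.
  by rewrite -!mulrA -!exprD; congr (_ * (_ * _ ^+ _)); lia.
apply: (sum_u_small_powers alpha_inj
  (fun j => - ((-1) ^+ j * sigma alpha j))
  (f := fun j => (n - j + (e - (k - r).+1))%N)) => j; lia.
Qed.

(** The first n columns suffice: a vanishing row combination there gives a polynomial of degree at
    most k < n with n roots, and its exponents are distinct. *)
Lemma row_free_G1mx : row_free (G1mx k r alpha).
Proof.
apply: inj_row_free => v; rewrite /G1mx mul_mx_row -[X in _ = X -> _]row_mx0.
case/eq_row_mx => vG0 _.
pose p := \sum_(i < k) v 0 i *: 'X^(bump (k - r) i).
have p0 : p = 0.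
  apply: (poly_eq0_at_points alpha_inj) => [|j].
    apply: (leq_trans (size_sum _ _ _)); apply/bigmax_leqP => i _.
    rewrite (leq_trans (size_scale_leq _ _)) // size_polyXn /bump.
    by have := ltn_ord i; lia.
  move/rowP/(_ j): vG0; rewrite !mxE horner_sum => sum0; rewrite -[RHS]sum0.
  by apply: eq_bigr => i _; rewrite hornerZ hornerXn mxE.
apply/rowP => i; rewrite mxE; move/(congr1 (coefp (bump (k - r) i))): p0.
rewrite /= coef0 coef_sum (bigD1 i) //= big1 ?addr0 => [|l neq_li].
  by rewrite coefZ coefXn eqxx mulr1.
rewrite coefZ coefXn (can_eq (bumpK _)) [_ == _ :> nat]eq_sym.
by rewrite val_eqE (negPf neq_li) mulr0.
Qed.

(** Up to the nonzero weights [u], the first n columns evaluate 1, X, ..., X^(n-k-1) and the monic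
    polynomial behind [Lambda], of degree n - k + r - 1. These degrees are distinct, as r > 0, and
    below n, as r < k. *)
Lemma row_free_H1mx : row_free (H1mx k r alpha).
Proof.
apply: inj_row_free => v; rewrite /H1mx mul_mx_row -[X in _ = X -> _]row_mx0.
case/eq_row_mx => vH0 _.
pose m := (n - k - 1)%N.
pose Lpoly : {poly F} := \sum_(0 <= j < r.+1)
  ((-1) ^+ j * sigma alpha j) *: 'X^((n - k) + (r - 1) - j).
(* [minn i m] covers both the rows before [m], of exponent i, and the last row m + 1, of exponent
   [m]. *)
pose q (i : nat) := if i == m then Lpoly else 'X^(minn i m).
pose p := \sum_(i < n - k + 1) v 0 i *: q i.
have sz_Lpoly : (size Lpoly <= n)%N.
  rewrite /Lpoly big_nat; apply: (leq_trans (size_sum _ _ _)).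
  apply/bigmax_leqP_seq => j _ lt_jr.
  rewrite (leq_trans (size_scale_leq _ _)) // size_polyXn.
  by move: lt_jr; lia.
have p0 : p = 0.
  apply: (poly_eq0_at_points alpha_inj) => [|j].
    apply: (leq_trans (size_sum _ _ _)); apply/bigmax_leqP => i _.
    rewrite (leq_trans (size_scale_leq _ _)) // /q; case: eqP => // _.
    by rewrite size_polyXn /m; lia.
  apply: (mulfI (u_neq0 alpha_inj j)); rewrite mulr0.
  move/rowP/(_ j): vH0; rewrite !mxE horner_sum mulr_sumr => sum0; rewrite -[RHS]sum0.
  apply: eq_bigr => i _; rewrite hornerZ mxE mulrCA; congr (_ * (_ * _)).
  rewrite /q -/m; case: ltngtP => [lt_im|lt_mi|_].
  - by rewrite hornerXn; congr (_ ^+ _); lia.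
  - by rewrite hornerXn; congr (_ ^+ _); lia.
  - by rewrite horner_sum; apply: eq_bigr => l _; rewrite hornerZ hornerXn.
have lt_m : (m < n - k + 1)%N by rewrite /m; lia.
have sigma0 : sigma alpha 0 = 1.
  rewrite /sigma (big_pred1 set0) ?big_set0 // => A.
  by rewrite cards_eq0.
(* Only [Lpoly] reaches degree n - k + r - 1 > m, with coefficient sigma_0 = 1. *)
have v_m : v 0 (Ordinal lt_m) = 0.
  move/(congr1 (coefp (n - k + (r - 1)))): p0.
  rewrite /= coef0 coef_sum (bigD1 (Ordinal lt_m)) //= big1 ?addr0 => [|i neq_im].
    rewrite coefZ /q eqxx coef_sum big_nat_recl // big_nat big1 ?addr0 => [|j lt_jr].
      by rewrite coefZ coefXn subn0 eqxx expr0 mul1r sigma0 !mulr1.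
    rewrite coefZ coefXn; case: eqP; last by rewrite mulr0.
    by move: lt_jr; lia.
  rewrite coefZ /q; move: neq_im; rewrite -val_eqE /= => /negPf ->.
  rewrite coefXn; case: eqP; last by rewrite mulr0.
  by rewrite /m; lia.
apply/rowP => i; rewrite [RHS]mxE.
have [i_m|neq_im] := eqVneq (i : nat) m.
  by rewrite -v_m; congr (v 0 _); apply: val_inj.
(* Away from row [m], [minn i m] is injective, so each remaining coefficient isolates one entry of
   [v]. *)
move/(congr1 (coefp (minn i m))): p0.
rewrite /= coef0 coef_sum (bigD1 i) //= big1 ?addr0 => [|l neq_li].
  by rewrite /q (negPf neq_im) coefZ coefXn eqxx mulr1.
have [l_m|neq_lm] := eqVneq (l : nat) m.
  have -> : l = Ordinal lt_m by apply: val_inj.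
  by rewrite v_m scale0r coef0.
rewrite /q (negPf neq_lm) coefZ coefXn; case: eqP; last by rewrite mulr0.
have := ltn_ord i; have := ltn_ord l; move: neq_li neq_lm neq_im.
by rewrite -val_eqE /= /m; lia.
Qed.

Lemma H1mx_orthogonal : H1mx k r alpha *m (G1mx k r alpha)^T = 0.
Proof.
apply/matrixP => i l; rewrite /H1mx /G1mx tr_row_mx mul_row_col !mxE big_ord1 !mxE.
set e := bump (k - r) l.
have [le_ek neq_e] : (e <= k)%N /\ e != (k - r)%N.
  by rewrite /e /bump; have := ltn_ord l; lia.
(* The appended 1 sits in the row of exponent k: since r > 0, the omitted exponent lies below k. *)
have e_k : (l.+1 == k) = (e == k).
  by rewrite /e /bump; have := ltn_ord l; lia.
under eq_bigr do rewrite !mxE -/e -mulrA.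
(* Early rows only meet exponents i + e <= n - 2. In the last row n - k - 1 + e reaches n - 1
   exactly when e = k, and the entry -1 cancels that 1. *)
have [lt_i|gt_i|eq_i] := ltngtP i (n - k - 1)%N.
- under eq_bigr do rewrite -exprD.
  rewrite sum_u_exp //; last by lia.
  by rewrite !ifN_eq ?mul0r ?addr0; lia || (case: eqP => //; lia).
- have -> : i = (n - k)%N :> nat by have := ltn_ord i; lia.
  under eq_bigr do rewrite -exprD.
  rewrite sum_u_exp //; last by lia.
  rewrite eqxx mulN1r e_k; apply/eqP; rewrite subr_eq0; apply/eqP.
  by congr (_%:R); congr nat_of_bool; lia.
- rewrite sum_u_Lambda // eq_i ifN_eq ?mul0r ?addr0 //.
  by lia.
Qed.

End ParityCheck.

Theorem theorem4p3 (F : finFieldType) (n k r : nat) (alpha : 'I_n -> F)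
    (alpha_inj : injective alpha)
    (r_ge1 : (1 <= r)%N) (r_le : (r <= k - 1)%N) (k_lt : (k < n)%N) :
  is_parity_check (C1 k r alpha) (H1mx k r alpha).
Proof.
have lt_rk : (r < k)%N by lia.
apply: parity_check_of_orthogonal; last by lia.
- exact: row_free_G1mx.
- exact: row_free_H1mx.
- exact: H1mx_orthogonal.
Qed.
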